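(* Let $a,b,c>0$ be real numbers, and for $x\in(0,\infty)$ define $$h_{a,b;c}(x)=\biggl[c\,\frac{\Gamma(x+a)}{\Gamma(x+b)}\biggr]^{1/x},$$ where $\Gamma$ is the Euler gamma function. (1) If $a>b$, then the function $h_{a,b;c}$ is logarithmically completely monotonic on $(0,\infty)$ if and only if $c\ge\frac{\Gamma(b)}{\Gamma(a)}$. (2) If $a<b$, then the reciprocal function $1/h_{a,b;c}$ is logarithmically completely monotonic on $(0,\infty)$ if and only if $c\le\frac{\Gamma(b)}{\Gamma(a)}$.
   Context: The Euler gamma function is $\Gamma(x)=\int_0^\infty t^{x-1}e^{-t}\,dt$ for $x>0$. An infinitely differentiable function $f$ (positive, so that $\ln f$ is defined) is said to be logarithmically completely monotonic on an interval $I$ if $(-1)^k[\ln f(x)]^{(k)}\ge 0$ for all $x\in I$ and all $k\in\mathbb{N}=\{1,2,\dots\}$, where $[\ln f(x)]^{(k)}$ denotes the $k$-th derivative of $\ln f$ at $x$. *)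

(* Defs.v *)
From Stdlib Require Import Reals.
From Coquelicot Require Import Coquelicot.
Open Scope R_scope.

(* The integral is improper at both ends, and it converges for x > 0;
   elsewhere the value is a meaningless default. *)
Definition Gamma (x : R) : R :=
  RInt_gen (fun t => Rpower t (x - 1) * exp (- t))
           (at_right 0) (Rbar_locally p_infty).

(* The interval is the open one, with possibly infinite endpoints: Coquelicot's
   derivatives are two-sided, so they are the right notion only in the interior. *)
Definition in_open_interval (l u : Rbar) (x : R) : Prop :=
  Rbar_lt l x /\ Rbar_lt x u.

Definition log_completely_monotonic (l u : Rbar) (f : R -> R) : Prop :=
  (forall x, in_open_interval l u x -> 0 < f x) /\
  (forall x, in_open_interval l u x -> forall n : nat, ex_derive_n f n x) /\
  (forall x, in_open_interval l u x -> forall k : nat, (1 <= k)%nat ->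
     0 <= (-1) ^ k * Derive_n (fun y => ln (f y)) k x).

Definition h (a b c x : R) : R :=
  Rpower (c * (Gamma (x + a) / Gamma (x + b))) (1 / x).

(* Main.v *)
Require Import Defs.
From Stdlib Require Import Reals Arith Lra Lia.
From Coquelicot Require Import Coquelicot.
Open Scope R_scope.

(* The logarithm of h is G(x) / x with G(x) = ln c + ln Gamma (x + a) - ln Gamma (x + b).
   Put w_0 = G and w_k(x) = x^k G^(k)(x) - k w_(k-1)(x). Then (G(x) / x)^(k) = w_k(x) / x^(k+1)
   and w_k'(x) = x^k G^(k+1)(x), while (-1)^k w_k(0) = k! G(0). So if (-1)^k G^(k+1) >= 0 for
   all k, then G(x) / x is completely monotonic as soon as G(0) >= 0, and conversely a
   nonincreasing G(x) / x forces G(0) >= 0. For a > b the sign condition on G says that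
   (-1)^k (ln Gamma)^(k+1) is nondecreasing, which is read off the series
   (ln Gamma)''(x) = sum 1 / (x + k)^2 differentiated termwise. That series comes from Gauss'
   product, obtained from Gamma (x + 1) = x Gamma x and Gamma (y + d) <= y^d Gamma y for
   0 <= d <= 1. The case a < b is the first one with a and b exchanged and c inverted. *)

(** * Complete monotonicity of a quotient by x *)

(** The derivatives are carried as explicit functions on all of [x > 0]. In this form closure under
    sums, products and [exp] is a plain induction on the order, unlike for the pointwise
    [ex_derive_n]. *)
Fixpoint n_derivable (n : nat) (f : R -> R) : Prop :=
  match n with
  | O => True
  | S n => exists f', (forall x, 0 < x -> is_derive f x (f' x)) /\ n_derivable n f'
  end.

Lemma n_derivable_pred n f : n_derivable (S n) f -> n_derivable n f.
Proof.
  revert f; induction n as [|n IH]; intros f [f' [Hf Hn]]; simpl; auto.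
  exists f'; split; auto.
Qed.

Lemma n_derivable_plus n f g :
  n_derivable n f -> n_derivable n g -> n_derivable n (fun x => f x + g x).
Proof.
  revert f g; induction n as [|n IH]; intros f g; simpl; auto.
  intros [f' [Hf Hf']] [g' [Hg Hg']].
  exists (fun x => f' x + g' x); split; auto.
  intros x Hx; apply (is_derive_plus f g); auto.
Qed.

Lemma n_derivable_mult n f g :
  n_derivable n f -> n_derivable n g -> n_derivable n (fun x => f x * g x).
Proof.
  revert f g; induction n as [|n IH]; intros f g Hf0 Hg0; simpl; auto.
  pose proof (n_derivable_pred _ _ Hf0) as Hf1; pose proof (n_derivable_pred _ _ Hg0) as Hg1.
  destruct Hf0 as [f' [Hf Hf']]; destruct Hg0 as [g' [Hg Hg']].
  exists (fun x => f' x * g x + f x * g' x); split.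
  - intros x Hx; apply (is_derive_mult f g); auto. intros; apply Rmult_comm.
  - apply n_derivable_plus; apply IH; auto.
Qed.

Lemma n_derivable_exp n f :
  n_derivable n f -> n_derivable n (fun x => exp (f x)).
Proof.
  revert f; induction n as [|n IH]; intros f Hf0; simpl; auto.
  pose proof (n_derivable_pred _ _ Hf0) as Hf1.
  destruct Hf0 as [f' [Hf Hf']].
  exists (fun x => f' x * exp (f x)); split.
  - intros x Hx; apply (is_derive_comp exp f); auto. apply is_derive_exp.
  - apply n_derivable_mult; auto.
Qed.

Lemma locally_pos x : 0 < x -> locally x (fun y => 0 < y).
Proof. intros Hx; apply (open_gt 0 x Hx). Qed.

Lemma Derive_n_chain (F : nat -> R -> R) (f : R -> R) :
  (forall k x, 0 < x -> is_derive (F k) x (F (S k) x)) ->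
  (forall x, 0 < x -> f x = F O x) ->
  forall k x, 0 < x -> Derive_n f k x = F k x.
Proof.
  intros HF H0 k; induction k as [|k IH]; intros x Hx; [now apply H0|].
  simpl; apply is_derive_unique.
  apply is_derive_ext_loc with (F k); [|now apply HF].
  apply filter_imp with (2 := locally_pos x Hx); intros y Hy; now rewrite IH.
Qed.

Lemma ex_derive_n_of_n_derivable n f x :
  n_derivable n f -> 0 < x -> ex_derive_n f n x.
Proof.
  intros Hf Hx; destruct n as [|n]; [exact I|].
  (* Generalised for the induction: after [m] derivations there remains, on the positive reals, a
     function that can still be derived [n] times. The case [n = 1] gives the goal. *)
  enough (H : forall m n f, n_derivable (m + n) f ->
    exists g, n_derivable n g /\ forall x, 0 < x -> Derive_n f m x = g x).
  { replace (S n) with (n + 1)%nat in Hf by lia.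
    destruct (H n 1%nat f Hf) as [g [[g' [Hg _]] Hfg]].
    exists (g' x). apply is_derive_ext_loc with g; [|now apply Hg].
    apply filter_imp with (2 := locally_pos x Hx); intros y Hy; symmetry; now apply Hfg. }
  clear; intros m; induction m as [|m IH]; intros n f Hf.
  - exists f; split; auto.
  - replace (S m + n)%nat with (m + S n)%nat in Hf by lia.
    destruct (IH (S n) f Hf) as [g [[g' [Hg Hg']] Hfg]].
    exists g'; split; auto. intros x Hx; simpl.
    apply is_derive_unique, is_derive_ext_loc with g; [|now apply Hg].
    apply filter_imp with (2 := locally_pos x Hx); intros y Hy; symmetry; now apply Hfg.
Qed.

Lemma incr_from_derive (f f' : R -> R) (x y : R) :
  x <= y -> (forall z, x <= z <= y -> is_derive f z (f' z)) ->
  (forall z, x <= z <= y -> 0 <= f' z) -> f x <= f y.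
Proof.
  intros Hxy Hd Hp.
  destruct (MVT_gen f x y f') as [z [Hz E]];
    rewrite ?Rmin_left, ?Rmax_right in * by lra.
  - intros z Hz; apply Hd; lra.
  - intros z Hz; apply continuity_pt_filterlim, (ex_derive_continuous f).
    exists (f' z); apply Hd; lra.
  - specialize (Hp z Hz). nra.
Qed.

Section Quotient.
Variable G : nat -> R -> R.
Hypothesis G_derive : forall k x, 0 <= x -> is_derive (G k) x (G (S k) x).

(* With [phi = G O x / x] one has [quot_num k x = x ^ (k + 1) phi^(k)(x)]; unlike
   [phi^(k)] it extends to [x = 0], and its derivative [x ^ k * G (S k) x] has constant sign. *)
Fixpoint quot_num (k : nat) (x : R) : R :=
  match k with
  | O => G O x
  | S k' => x ^ k * G k x - INR k * quot_num k' x
  end.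

(** Deriving the factor [x ^ k] produces [k * x ^ (k - 1) * G k x], which the derivative of the
    subtracted multiple of the previous numerator cancels. *)
Lemma quot_num_derive k x :
  0 <= x -> is_derive (quot_num k) x (x ^ k * G (S k) x).
Proof.
  intros Hx; induction k as [|k IH].
  - simpl; rewrite Rmult_1_l; now apply G_derive.
  - pose proof (G_derive (S k) x Hx) as HG.
    apply is_derive_ext with (fun y => y ^ (S k) * G (S k) y - INR (S k) * quot_num k y).
    { intros; reflexivity. }
    evar_last.
    + apply (is_derive_minus (fun y => y ^ S k * G (S k) y)).
      * apply (is_derive_mult (fun y => y ^ S k)).
        -- apply is_derive_pow, is_derive_id.
        -- exact HG.
        -- intros; apply Rmult_comm.
      * apply is_derive_scal, IH.
    + unfold minus, plus, opp, mult, one; simpl pred; cbn -[INR pow].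
      unfold mult; simpl; ring.
Qed.

(** The recursion of [quot_num] is the numerator left by the quotient rule once the common factor
    [x ^ k] is removed. *)
Lemma quot_derive k x :
  0 < x -> is_derive (fun y => quot_num k y / y ^ S k) x (quot_num (S k) x / x ^ S (S k)).
Proof.
  intros Hx.
  assert (Hn : x ^ S k <> 0) by (apply pow_nonzero; lra).
  evar_last.
  - apply is_derive_div; [apply quot_num_derive; lra | apply is_derive_pow, is_derive_id | exact Hn].
  - cbn [pred quot_num]. unfold one; simpl.
    assert (x ^ k <> 0) by (apply pow_nonzero; lra).
    field; lra.
Qed.

Lemma quot_num_0 k : (-1) ^ k * quot_num k 0 = INR (fact k) * G O 0.
Proof.
  induction k as [|k IH]; [simpl; ring|].
  cbn [quot_num]. rewrite pow_ne_zero by lia.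
  rewrite fact_simpl, mult_INR, Rmult_assoc, <- IH; simpl pow; ring.
Qed.

Hypothesis G_sign : forall k x, 0 <= x -> 0 <= (-1) ^ k * G (S k) x.

(** The signed numerator is nondecreasing on [x >= 0] and starts at [INR (fact k) * G O 0]. *)
Lemma quot_sign k x : 0 <= G O 0 -> 0 < x -> 0 <= (-1) ^ k * (quot_num k x / x ^ S k).
Proof.
  intros H0 Hx.
  assert (0 < x ^ S k) by (apply pow_lt; lra).
  replace ((-1) ^ k * (quot_num k x / x ^ S k)) with ((-1) ^ k * quot_num k x / x ^ S k)
    by (field; lra).
  apply Rdiv_le_0_compat; auto.
  apply Rle_trans with ((-1) ^ k * quot_num k 0).
  - rewrite quot_num_0; apply Rmult_le_pos; auto; apply pos_INR.
  - apply (incr_from_derive (fun y => (-1) ^ k * quot_num k y)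
             (fun y => (-1) ^ k * (y ^ k * G (S k) y))); try lra.
    + intros z Hz; apply is_derive_scal, quot_num_derive; lra.
    + intros z Hz.
      assert (0 <= z ^ k) by (apply pow_le; lra).
      pose proof (G_sign k z (proj1 Hz)). nra.
Qed.

Lemma exp_quot_lcm_iff (f : R -> R) :
  (forall x, 0 < x -> f x = exp (G O x / x)) ->
  (log_completely_monotonic 0 p_infty f <-> 0 <= G O 0).
Proof.
  intros Hf.
  assert (Hln : forall x, 0 < x -> ln (f x) = quot_num 0 x / x ^ 1).
  { intros x Hx; rewrite Hf, ln_exp by auto; simpl; now rewrite Rmult_1_r. }
  assert (HD : forall k x, 0 < x -> Derive_n (fun y => ln (f y)) k x = quot_num k x / x ^ S k).
  { apply (Derive_n_chain (fun k x => quot_num k x / x ^ S k)).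
    - intros; now apply quot_derive.
    - exact Hln. }
  split.
  - intros [_ [_ Hs]].
    destruct (Rle_or_lt 0 (G O 0)) as [|Hneg]; auto. exfalso.
    (* Only order 1 of the monotonicity is used: [G O x / x] is nonincreasing, so on [(0, 1]] it is
       at least its value at 1. *)
    assert (Hmon : forall x, 0 < x <= 1 -> G O 1 * x <= G O x).
    { intros x Hx.
      assert (H : - (quot_num 0 x / x ^ 1) <= - (quot_num 0 1 / 1 ^ 1)).
      { apply (incr_from_derive (fun y => - (quot_num 0 y / y ^ 1))
                 (fun y => - (quot_num 1 y / y ^ 2))); try lra.
        - intros z Hz; apply (is_derive_opp (fun y => quot_num 0 y / y ^ 1)), quot_derive; lra.
        - intros z Hz. specialize (Hs z).
          assert (Hz' : in_open_interval 0 p_infty z) by (split; simpl; auto; lra).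
          specialize (Hs Hz' 1%nat (le_n _)). rewrite HD in Hs by lra. lra. }
      simpl in H. rewrite !Rmult_1_r, Rdiv_1_r in H.
      assert (G O 1 <= G O x / x) by lra.
      apply Rle_div_r in H0; lra. }
    (* At 0 this difference equals [G O 0 < 0]. By continuity it is still negative at some [x] in
       [(0, 1]], against [Hmon]. *)
    assert (Hc : continuous (fun x => G O x - G O 1 * x) 0).
    { apply (ex_derive_continuous (fun x => G O x - G O 1 * x)). eexists.
      apply (is_derive_minus (G O)); [apply G_derive; lra |].
      apply (is_derive_scal (fun x => x)), is_derive_id. }
    assert (Hlt : locally 0 (fun x => G O x - G O 1 * x < 0)).
    { apply (Hc (fun z => z < 0)). apply (open_lt 0). rewrite Rmult_0_r; lra. }
    destruct Hlt as [d Hd].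
    pose proof (cond_pos d) as Hdp.
    set (x := Rmin 1 (d / 2)).
    assert (Hx : 0 < x) by (apply Rmin_pos; lra).
    assert (x <= 1) by apply Rmin_l.
    assert (x <= d / 2) by apply Rmin_r.
    specialize (Hmon x (conj Hx H)).
    assert (Hb : ball 0 d x).
    { unfold ball; simpl; unfold AbsRing_ball, abs, minus, plus, opp; simpl.
      rewrite Rabs_pos_eq; lra. }
    specialize (Hd x Hb). simpl in Hd. lra.
  - intros H0. split; [|split].
    + intros x [Hx _]; rewrite Hf by exact Hx; apply exp_pos.
    + intros x [Hx _] n. simpl in Hx.
      enough (Hn : n_derivable n (fun y => exp (quot_num 0 y / y ^ 1))).
      { apply ex_derive_n_ext_loc with (fun y => exp (quot_num 0 y / y ^ 1)).
        - apply filter_imp with (2 := locally_pos x Hx); intros y Hy.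
          rewrite Hf by auto. simpl. now rewrite Rmult_1_r.
        - now apply ex_derive_n_of_n_derivable. }
      apply n_derivable_exp.
      (* Each derivation raises the index of [quot_num], so the induction must cover every starting
         index. *)
      generalize O; induction n as [|n IH]; intros k; [exact I|].
      exists (fun y => quot_num (S k) y / y ^ S (S k)); split.
      * intros y Hy; now apply quot_derive.
      * apply IH.
    + intros x [Hx _] k _. rewrite HD by exact Hx. now apply quot_sign.
Qed.
End Quotient.

(** * The Gamma function *)

Lemma exp_monotone x y : x <= y -> exp x <= exp y.
Proof. intros [H | ->]; [now apply Rlt_le, exp_increasing | apply Rle_refl]. Qed.

Definition Gamma_integrand (x t : R) : R := Rpower t (x - 1) * exp (- t).

Lemma Gamma_integrand_continuous x t : 0 < t -> continuous (Gamma_integrand x) t.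
Proof.
  intros Ht. apply (ex_derive_continuous (Gamma_integrand x)). unfold Gamma_integrand, Rpower.
  auto_derive; auto.
Qed.

Lemma Gamma_integrand_pos x t : 0 < Gamma_integrand x t.
Proof. apply Rmult_lt_0_compat; apply exp_pos. Qed.

Lemma Gamma_integrand_ex_RInt x a b : 0 < a -> 0 < b -> ex_RInt (Gamma_integrand x) a b.
Proof.
  intros Ha Hb. apply (ex_RInt_continuous (V := R_CompleteNormedModule)).
  intros t Ht. apply Gamma_integrand_continuous.
  apply Rlt_le_trans with (2 := proj1 Ht). now apply Rmin_glb_lt.
Qed.

(** From [ln s <= s - 1] at [s = t / (2 * x)]. The scale [2 * x] makes the polynomial factor cost
    exactly [exp (t / 2)], half of the available decay. *)
Lemma Gamma_integrand_decay x t : 0 < x -> 0 < t ->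
  Gamma_integrand (x + 1) t <= Rpower (2 * x) x * exp (- t / 2).
Proof.
  intros Hx Ht. unfold Gamma_integrand, Rpower.
  replace (x + 1 - 1) with x by ring. rewrite <- !exp_plus.
  apply exp_monotone. 
  assert (H : ln t <= ln (2 * x) + t / (2 * x)).
  { replace t with (2 * x * (t / (2 * x))) at 1 by (field; lra).
    assert (0 < t / (2 * x)) by (apply Rdiv_lt_0_compat; lra).
    rewrite ln_mult by lra. apply Rplus_le_compat_l.
    pose proof (exp_ineq1_le (ln (t / (2 * x)))) as He. rewrite exp_ln in He; lra. }
  apply Rmult_le_compat_l with (r := x) in H; [|lra].
  replace (x * (ln (2 * x) + t / (2 * x))) with (x * ln (2 * x) + t / 2) in H by (field; lra).
  lra.
Qed.

(** The antiderivative is the next integrand itself. The identity serves twice: it removes the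
    singularity at 0 in the convergence proof, and its limit is the functional equation. *)
Lemma Gamma_integral_by_parts x a b : 0 < a -> 0 < b ->
  x * RInt (Gamma_integrand x) a b =
  RInt (Gamma_integrand (x + 1)) a b + Gamma_integrand (x + 1) b - Gamma_integrand (x + 1) a.
Proof.
  intros Ha Hb.
  assert (H : is_RInt (fun t => x * Gamma_integrand x t - Gamma_integrand (x + 1) t) a b
     (Gamma_integrand (x + 1) b - Gamma_integrand (x + 1) a)).
  { apply (is_RInt_derive (Gamma_integrand (x + 1))).
    - intros t Ht.
      assert (Hp : 0 < t) by (apply Rlt_le_trans with (2 := proj1 Ht); now apply Rmin_glb_lt).
      unfold Gamma_integrand, Rpower. replace (x + 1 - 1) with x by ring.
      auto_derive; [lra|].
      replace ((x - 1) * ln t) with (x * ln t + - ln t) by ring.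
      rewrite exp_plus, (exp_Ropp (ln t)), exp_ln by lra. field; lra.
    - intros t Ht.
      assert (Hp : 0 < t) by (apply Rlt_le_trans with (2 := proj1 Ht); now apply Rmin_glb_lt).
      apply (continuous_minus (fun t => x * Gamma_integrand x t)).
      + apply (continuous_scal_r x (Gamma_integrand x)). now apply Gamma_integrand_continuous.
      + now apply Gamma_integrand_continuous. }
  assert (H' : is_RInt (fun t => x * Gamma_integrand x t - Gamma_integrand (x + 1) t) a b
     (x * RInt (Gamma_integrand x) a b - RInt (Gamma_integrand (x + 1)) a b)).
  { apply (is_RInt_minus (fun t => x * Gamma_integrand x t)).
    - apply (is_RInt_scal (Gamma_integrand x)).
      now apply (RInt_correct (V := R_CompleteNormedModule)), Gamma_integrand_ex_RInt.
    - now apply (RInt_correct (V := R_CompleteNormedModule)), Gamma_integrand_ex_RInt. }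
  pose proof (is_RInt_unique (V := R_CompleteNormedModule) _ _ _ _ H) as E.
  rewrite (is_RInt_unique (V := R_CompleteNormedModule) _ _ _ _ H') in E. lra.
Qed.

Lemma Gamma_integral_bounded x : 0 < x ->
  exists B, forall a b, 0 < a -> a <= b -> RInt (Gamma_integrand x) a b <= B.
Proof.
  intros Hx. set (C := Rpower (2 * x) x).
  assert (HC : 0 < C) by apply exp_pos.
  (* After integration by parts, [2 * C] bounds the integral of [C * exp (- t / 2)] and [C] the
     boundary term at [b]; the one at [a] enters negatively. *)
  exists (3 * C / x). intros a b Ha Hab.
  apply Rle_div_r; auto. rewrite Rmult_comm, Gamma_integral_by_parts by lra.
  assert (He : forall t, 0 < t -> exp (- t / 2) <= 1).
  { intros t Ht. rewrite <- exp_0. apply exp_monotone; lra. }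
  assert (H1 : RInt (Gamma_integrand (x + 1)) a b <= 2 * C).
  { assert (HI : is_RInt (fun t => C * exp (- t / 2)) a b
      (- 2 * C * exp (- b / 2) - (- 2 * C * exp (- a / 2)))).
    { apply (is_RInt_derive (fun t => - 2 * C * exp (- t / 2))).
      - intros t _. auto_derive; auto. unfold Rdiv. field.
      - intros t _. apply (ex_derive_continuous (fun t => C * exp (- t / 2))). auto_derive; auto. }
    apply Rle_trans with (RInt (fun t => C * exp (- t / 2)) a b).
    - apply RInt_le; auto.
      + apply Gamma_integrand_ex_RInt; lra.
      + eexists; exact HI.
      + intros t Ht; apply Gamma_integrand_decay; lra.
    - rewrite (is_RInt_unique _ _ _ _ HI).
      pose proof (He a Ha). pose proof (exp_pos (- b / 2)). nra. }
  assert (H2 : Gamma_integrand (x + 1) b <= C).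
  { apply Rle_trans with (1 := Gamma_integrand_decay x b Hx ltac:(lra)).
    fold C. pose proof (He b ltac:(lra)). nra. }
  pose proof (Gamma_integrand_pos (x + 1) a). lra.
Qed.

Lemma Gamma_integral_mono x a b a' b' : 0 < a' -> a' <= a -> a <= b -> b <= b' ->
  RInt (Gamma_integrand x) a b <= RInt (Gamma_integrand x) a' b'.
Proof.
  intros Ha' Ha Hab Hb.
  assert (Hpos : forall u v, 0 < u -> u <= v -> 0 <= RInt (Gamma_integrand x) u v).
  { intros u v Hu Huv. apply RInt_ge_0; auto.
    - apply Gamma_integrand_ex_RInt; lra.
    - intros; apply Rlt_le, Gamma_integrand_pos. }
  rewrite <- (RInt_Chasles (V := R_CompleteNormedModule) (Gamma_integrand x) a' a b')
    by (apply Gamma_integrand_ex_RInt; lra).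
  rewrite <- (RInt_Chasles (V := R_CompleteNormedModule) (Gamma_integrand x) a b b')
    by (apply Gamma_integrand_ex_RInt; lra).
  pose proof (Hpos a' a Ha' Ha). pose proof (Hpos b b' ltac:(lra) Hb).
  change plus with Rplus. lra.
Qed.

(** The integrals of a positive function over compact intervals grow with the interval and are
    bounded, so they converge to their supremum [l]. *)
Lemma Gamma_is_RInt_gen x : 0 < x ->
  is_RInt_gen (Gamma_integrand x) (at_right 0) (Rbar_locally p_infty) (Gamma x).
Proof.
  intros Hx. apply (RInt_gen_correct (V := R_CompleteNormedModule)).
  destruct (Gamma_integral_bounded x Hx) as [B HB].
  destruct (completeness (fun y => exists a b, 0 < a /\ a <= b /\ y = RInt (Gamma_integrand x) a b))
    as [l [Hub Hlub]].
  - exists B. intros y [a [b [Ha [Hab ->]]]]; now apply HB.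
  - exists (RInt (Gamma_integrand x) 1 1), 1, 1; repeat split; lra.
  - exists l. intros P [eps HP].
    destruct (Classical_Prop.classic
      (exists a b, 0 < a /\ a <= b /\ l - eps < RInt (Gamma_integrand x) a b))
      as [[a [b [Ha [Hab Hl]]]]|Hno].
    2:{ exfalso. assert (l <= l - eps); [|pose proof (cond_pos eps); lra].
        apply Hlub. intros y [a [b [Ha [Hab ->]]]].
        apply Rnot_lt_le; intros Hc; apply Hno; now exists a, b. }
    (* Any interval [[u, v]] containing [[a, b]] has an integral between [l - eps] and [l]. *)
    apply Filter_prod with (fun u => 0 < u < a) (fun v => b < v).
    + exists (mkposreal a Ha). intros u Hu Hu0. split; auto.
      unfold ball in Hu; simpl in Hu; unfold AbsRing_ball, abs, minus, plus, opp in Hu; simpl in Hu.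
      rewrite Ropp_0, Rplus_0_r, Rabs_pos_eq in Hu; lra.
    + exists b; auto.
    + intros u v Hu Hv. exists (RInt (Gamma_integrand x) u v). split.
      * apply (RInt_correct (V := R_CompleteNormedModule)), Gamma_integrand_ex_RInt; simpl; lra.
      * apply HP.
        assert (RInt (Gamma_integrand x) u v <= l) by (apply Hub; exists u, v; repeat split; lra).
        pose proof (Gamma_integral_mono x a b u v ltac:(lra) ltac:(lra) Hab ltac:(lra)).
        unfold ball; simpl; unfold AbsRing_ball, abs, minus, plus, opp; simpl.
        apply Rabs_lt_between; lra.
Qed.

(** Compact intervals exhausting the positive reals, so that limits along filters become limits of
    sequences. The shift by 1 keeps the endpoints meaningful and ordered at [n = 0]. *)
Definition Gamma_trunc (x : R) (n : nat) : R :=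
  RInt (Gamma_integrand x) (/ (INR n + 1)) (INR n + 1).

Lemma trunc_bounds n : 0 < / (INR n + 1) <= 1 /\ 1 <= INR n + 1.
Proof.
  pose proof (pos_INR n). split; [split|lra].
  - apply Rinv_0_lt_compat; lra.
  - rewrite <- Rinv_1. apply Rinv_le_contravar; lra.
Qed.

Lemma is_lim_seq_INR_plus_1 : is_lim_seq (fun n => INR n + 1) p_infty.
Proof.
  apply is_lim_seq_ext with (fun n => INR (S n)); [intros; apply S_INR|].
  apply (is_lim_seq_incr_1 INR), is_lim_seq_INR.
Qed.

Lemma is_lim_seq_inv_INR : is_lim_seq (fun n => / (INR n + 1)) 0.
Proof.
  apply (is_lim_seq_inv _ p_infty); [apply is_lim_seq_INR_plus_1 | discriminate].
Qed.

Lemma Gamma_trunc_lim x : 0 < x -> is_lim_seq (Gamma_trunc x) (Gamma x).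
Proof.
  intros Hx P HP.
  specialize (Gamma_is_RInt_gen x Hx P HP) as HG.
  destruct HG as [Q S HQ HS HQS].
  assert (HQ' : eventually (fun n => Q (/ (INR n + 1)))).
  { destruct HQ as [d Hd].
    destruct (is_lim_seq_inv_INR (ball 0 d) (locally_ball 0 d)) as [N HN].
    exists N; intros n Hn; apply Hd; [now apply HN | apply trunc_bounds]. }
  assert (HS' : eventually (fun n => S (INR n + 1))) by now apply is_lim_seq_INR_plus_1.
  unfold filtermap. generalize (filter_and _ _ HQ' HS'). apply filter_imp.
  intros n [Hq Hs]. destruct (HQS _ _ Hq Hs) as [y [Hy HPy]].
  simpl in Hy. unfold Gamma_trunc. now rewrite (is_RInt_unique _ _ _ _ Hy).
Qed.

Lemma Gamma_pos x : 0 < x -> 0 < Gamma x.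
Proof.
  intros Hx.
  apply Rlt_le_trans with (RInt (Gamma_integrand x) 1 2).
  - apply RInt_gt_0; try lra.
    + intros; apply Gamma_integrand_pos.
    + intros t Ht; apply Gamma_integrand_continuous; lra.
  - apply (is_lim_seq_le_loc (fun _ => RInt (Gamma_integrand x) 1 2) (Gamma_trunc x)
      (RInt (Gamma_integrand x) 1 2) (Gamma x)).
    (* From [n = 1] on, the truncation interval contains [[1, 2]]. *)
    + exists 1%nat. intros n Hn. apply Gamma_integral_mono; try apply trunc_bounds; try lra.
      apply le_INR in Hn; simpl in Hn; lra.
    + apply is_lim_seq_const.
    + now apply Gamma_trunc_lim.
Qed.

(** Limit of the integration by parts. The lower boundary term is at most [(n + 1) ^ (- x)], and the
    upper one decays exponentially. *)
Lemma Gamma_succ x : 0 < x -> Gamma (x + 1) = x * Gamma x.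
Proof.
  intros Hx.
  assert (Hlow : is_lim_seq (fun n => Gamma_integrand (x + 1) (/ (INR n + 1))) 0).
  { apply is_lim_seq_le_le with (fun _ => 0) (fun n => exp (- x * ln (INR n + 1))).
    - intros n. split; [apply Rlt_le, Gamma_integrand_pos|].
      destruct (trunc_bounds n) as [H1 H2].
      unfold Gamma_integrand, Rpower. rewrite <- exp_plus. apply exp_monotone.
      rewrite ln_Rinv by lra. lra.
    - apply is_lim_seq_const.
    - apply (is_lim_comp_seq exp _ m_infty 0).
      + apply is_lim_exp_m.
      + exists O; intros; discriminate.
      + replace m_infty with (Rbar_mult (- x) p_infty).
        * apply is_lim_seq_scal_l.
          apply (is_lim_comp_seq ln _ p_infty p_infty).
          -- apply is_lim_ln_p.
          -- exists O; intros; discriminate.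
          -- apply is_lim_seq_INR_plus_1.
        * simpl. destruct Rle_dec; [exfalso; lra|]. reflexivity. }
  assert (Hup : is_lim_seq (fun n => Gamma_integrand (x + 1) (INR n + 1)) 0).
  { apply is_lim_seq_le_le with (fun _ => 0)
      (fun n => Rpower (2 * x) x * exp (- / 2 * (INR n + 1))).
    - intros n. split; [apply Rlt_le, Gamma_integrand_pos|].
      destruct (trunc_bounds n) as [H1 H2].
      replace (- / 2 * (INR n + 1)) with (- (INR n + 1) / 2) by field.
      apply Gamma_integrand_decay; lra.
    - apply is_lim_seq_const.
    - evar_last.
      + apply is_lim_seq_scal_l.
        apply (is_lim_comp_seq exp _ m_infty 0).
        * apply is_lim_exp_m.
        * exists O; intros; discriminate.
        * replace m_infty with (Rbar_mult (- / 2) p_infty).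
          -- apply is_lim_seq_scal_l, is_lim_seq_INR_plus_1.
          -- simpl. destruct Rle_dec; [exfalso; lra|]. reflexivity.
      + simpl. now rewrite Rmult_0_r. }
  assert (H : is_lim_seq (fun n => x * Gamma_trunc x n) (Gamma (x + 1) + 0 - 0)).
  { apply is_lim_seq_ext with (fun n => Gamma_trunc (x + 1) n
      + Gamma_integrand (x + 1) (INR n + 1) - Gamma_integrand (x + 1) (/ (INR n + 1))).
    - intros n. symmetry. apply Gamma_integral_by_parts; pose proof (trunc_bounds n); lra.
    - apply is_lim_seq_minus'; [apply is_lim_seq_plus'|]; auto.
      apply Gamma_trunc_lim; lra. }
  apply is_lim_seq_unique in H.
  pose proof (is_lim_seq_unique _ _ (is_lim_seq_scal_l _ x _ (Gamma_trunc_lim x Hx))) as H'.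
  rewrite H in H'. simpl in H'. injection H'. lra.
Qed.

(** The usual inequality between [t ^ d * s ^ (1 - d)] and [(1 - d) * s + d * t], multiplied by
    [s ^ d]. By homogeneity it reduces to the ratio [t / s]. *)
Lemma weighted_AM_GM s t d : 0 < s -> 0 < t -> 0 <= d <= 1 ->
  Rpower t d * s <= Rpower s d * ((1 - d) * s + d * t).
Proof.
  intros Hs Ht Hd.
  assert (Hr : 0 < t / s) by now apply Rdiv_lt_0_compat.
  assert (H : Rpower (t / s) d <= 1 - d + d * (t / s)).
  { (* Convexity of [exp]: combine its tangent lines at [d r], with [r = ln (t / s)]. *)
    set (r := ln (t / s)).
    assert (E : t / s = exp r) by (unfold r; now rewrite exp_ln).
    unfold Rpower. fold r. rewrite E.
    pose proof (exp_ineq1_le (- (d * r))) as H1.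
    pose proof (exp_ineq1_le (r - d * r)) as H2.
    pose proof (exp_pos (d * r)) as H3.
    replace r with (d * r + (r - d * r)) at 2 by ring. rewrite exp_plus.
    assert (H4 : exp (d * r) * exp (- (d * r)) = 1)
      by (rewrite <- exp_plus, Rplus_opp_r; apply exp_0).
    assert (H5 : 1 <= (1 - d) * exp (- (d * r)) + d * exp (r - d * r)).
    { apply Rmult_le_compat_l with (r := 1 - d) in H1; [|lra].
      apply Rmult_le_compat_l with (r := d) in H2; [|lra]. lra. }
    apply Rmult_le_compat_l with (r := exp (d * r)) in H5; [|lra].
    replace (exp (d * r) * ((1 - d) * exp (- (d * r)) + d * exp (r - d * r)))
      with ((1 - d) * (exp (d * r) * exp (- (d * r))) + d * (exp (d * r) * exp (r - d * r)))
      in H5 by ring.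
    rewrite H4 in H5. lra. }
  replace t with (s * (t / s)) at 1 by (field; lra).
  rewrite <- Rpower_mult_distr by auto.
  assert (0 < Rpower s d) by apply exp_pos.
  replace ((1 - d) * s + d * t) with ((1 - d + d * (t / s)) * s) by (field; lra).
  rewrite Rmult_assoc. apply Rmult_le_compat_l; [lra|].
  apply Rmult_le_compat_r; lra.
Qed.

(** The weighted mean inequality with [s = y], integrated against the integrand of [Gamma y], takes
    the place of Hölder's inequality. With [s = y] and [Gamma (y + 1) = y * Gamma y], the weights
    [1 - d] and [d] recombine into [y * Gamma y]. *)
Lemma Gamma_shift_le y d : 0 < y -> 0 <= d <= 1 -> Gamma (y + d) <= Rpower y d * Gamma y.
Proof.
  intros Hy Hd.
  enough (H : y * Gamma (y + d) <= Rpower y d * ((1 - d) * y * Gamma y + d * Gamma (y + 1))).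
  { rewrite Gamma_succ in H by auto. apply Rmult_le_reg_l with y; auto.
    replace (y * (Rpower y d * Gamma y))
      with (Rpower y d * ((1 - d) * y * Gamma y + d * (y * Gamma y))) by ring. exact H. }
  apply (is_lim_seq_le (fun n => y * Gamma_trunc (y + d) n)
    (fun n => Rpower y d * ((1 - d) * y * Gamma_trunc y n + d * Gamma_trunc (y + 1) n))
    (y * Gamma (y + d)) (Rpower y d * ((1 - d) * y * Gamma y + d * Gamma (y + 1)))).
  - intros n. destruct (trunc_bounds n) as [H1 H2]. unfold Gamma_trunc.
    set (a := / (INR n + 1)) in *. set (b := INR n + 1) in *.
    assert (Hex : forall x, ex_RInt (Gamma_integrand x) a b)
      by (intros; apply Gamma_integrand_ex_RInt; lra).
    assert (Hcv : forall x, is_RInt (Gamma_integrand x) a b (RInt (Gamma_integrand x) a b))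
      by (intros; now apply (RInt_correct (V := R_CompleteNormedModule))).
    refine (is_RInt_le (fun t => y * Gamma_integrand (y + d) t)
      (fun t => Rpower y d * ((1 - d) * y * Gamma_integrand y t + d * Gamma_integrand (y + 1) t))
      a b _ _ _ _ _ _); [lra| | |].
    + apply (is_RInt_scal (Gamma_integrand (y + d))), Hcv.
    + apply (is_RInt_scal (fun t => (1 - d) * y * Gamma_integrand y t + d * Gamma_integrand (y + 1) t)).
      apply (is_RInt_plus (fun t => (1 - d) * y * Gamma_integrand y t)).
      * apply (is_RInt_scal (Gamma_integrand y)), Hcv.
      * apply (is_RInt_scal (Gamma_integrand (y + 1))), Hcv.
    + intros t Ht. assert (Ht0 : 0 < t) by lra. unfold Gamma_integrand.
      replace (y + d - 1) with ((y - 1) + d) by ring.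
      replace (y + 1 - 1) with ((y - 1) + 1) by ring.
      rewrite !Rpower_plus, Rpower_1 by auto.
      pose proof (weighted_AM_GM y t d Hy Ht0 Hd) as HA.
      pose proof (exp_pos (- t)). assert (0 < Rpower t (y - 1)) by apply exp_pos.
      assert (0 < Rpower t (y - 1) * exp (- t)) by now apply Rmult_lt_0_compat.
      apply Rmult_le_compat_r with (r := Rpower t (y - 1) * exp (- t)) in HA; lra.
  - apply (is_lim_seq_scal_l _ y (Gamma (y + d))). apply Gamma_trunc_lim; lra.
  - apply (is_lim_seq_scal_l _ (Rpower y d) ((1 - d) * y * Gamma y + d * Gamma (y + 1))).
    apply is_lim_seq_plus'.
    + apply (is_lim_seq_scal_l _ ((1 - d) * y) (Gamma y)). now apply Gamma_trunc_lim.
    + apply (is_lim_seq_scal_l _ d (Gamma (y + 1))). apply Gamma_trunc_lim; lra.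
Qed.

(** * Logarithmic estimates and Gauss' product formula *)

Lemma ln_Gamma_succ x : 0 < x -> ln (Gamma (x + 1)) = ln x + ln (Gamma x).
Proof. intros Hx. rewrite Gamma_succ, ln_mult; auto. now apply Gamma_pos. Qed.

Lemma ln_Gamma_shift_le y d : 0 < y -> 0 <= d <= 1 ->
  ln (Gamma (y + d)) <= d * ln y + ln (Gamma y).
Proof.
  intros Hy Hd. pose proof (Gamma_pos y Hy).
  assert (E : d * ln y = ln (Rpower y d)) by (unfold Rpower; now rewrite ln_exp).
  rewrite E, <- ln_mult by (auto; apply exp_pos).
  apply ln_le; [apply Gamma_pos; lra | now apply Gamma_shift_le].
Qed.

Lemma ln_le_reg x y : 0 < y -> ln x <= ln y -> x <= y.
Proof.
  intros Hy H. apply Rnot_lt_le; intros Hlt.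
  pose proof (ln_increasing y x Hy Hlt); lra.
Qed.

Lemma ln_lipschitz m u v : 0 < m -> m <= u -> m <= v -> Rabs (ln u - ln v) <= Rabs (u - v) * / m.
Proof.
  intros Hm.
  assert (H : forall u v, m <= u -> u <= v -> 0 <= ln v - ln u <= (v - u) * / m).
  { clear u v; intros u v Hu Hv. rewrite <- ln_div by lra. split.
    - rewrite <- ln_1. apply ln_le; [lra|]. apply Rle_div_r; lra.
    - assert (Hr : 0 < v / u) by (apply Rdiv_lt_0_compat; lra).
      pose proof (exp_ineq1_le (ln (v / u))) as He. rewrite exp_ln in He by auto.
      apply Rle_trans with ((v - u) * / u).
      + replace ((v - u) * / u) with (v / u - 1) by (field; lra). lra.
      + apply Rmult_le_compat_l; [lra|]. apply Rinv_le_contravar; lra. }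
  intros Hu Hv. destruct (Rle_or_lt u v) as [Huv|Huv].
  - pose proof (H u v Hu Huv). rewrite Rabs_minus_sym, (Rabs_minus_sym u), !Rabs_pos_eq; lra.
  - pose proof (H v u Hv ltac:(lra)). rewrite !Rabs_pos_eq; lra.
Qed.

(* The error in Gauss' formula
   [ln Gamma x = lim ((x - 1) ln (n + 2) + ln (n + 1)! - sum_(k <= n) ln (x + k))],
   with [ln Gamma (n + 2)] for the factorial. *)
Definition Gauss_remainder (x : R) (n : nat) : R :=
  (x - 1) * ln (INR n + 2) + ln (Gamma (INR n + 2)) - ln (Gamma (x + INR n + 1)).

(** For [x <= 1], the shift inequality from [y] to [y + x] and from [y + x] to [y + 1], with
    [y = n + 1], squeezes the remainder between [- / (n + 1)] and 0. Passing from [x - 1] to [x]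
    adds [ln (n + 2) - ln (x + n)], which tends to 0. *)
Lemma Gauss_remainder_lim x : 0 < x -> is_lim_seq (Gauss_remainder x) 0.
Proof.
  (* The integer part only supplies some [N] with [x <= INR N + 1], on which the induction runs. *)
  intros Hx. destruct (nfloor_ex x) as [N [_ HN]]; [lra|].
  apply Rlt_le in HN. revert x Hx HN.
  assert (Hbase : forall x, 0 < x <= 1 -> is_lim_seq (Gauss_remainder x) 0).
  { intros x Hx. apply is_lim_seq_le_le with (fun n => - / (INR n + 1)) (fun _ => 0).
    - intros n. pose proof (pos_INR n) as Hn. unfold Gauss_remainder.
      set (y := INR n + 1).
      assert (Hy : 0 < y) by (unfold y; lra).
      replace (INR n + 2) with (y + 1) by (unfold y; ring).
      replace (x + INR n + 1) with (y + x) by (unfold y; ring).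
      pose proof (ln_Gamma_shift_le y x Hy ltac:(lra)) as H1.
      pose proof (ln_Gamma_shift_le (y + x) (1 - x) ltac:(lra) ltac:(lra)) as H2.
      replace (y + x + (1 - x)) with (y + 1) in H2 by ring.
      pose proof (ln_lipschitz y (y + 1) y Hy ltac:(lra) ltac:(lra)) as H3.
      replace (y + 1 - y) with 1 in H3 by ring. rewrite Rabs_R1, Rmult_1_l in H3.
      pose proof (Rle_trans _ _ _ (Rle_abs _) H3) as H4.
      assert (H5 : ln (y + x) <= ln (y + 1)) by (apply ln_le; lra).
      assert (H6 : ln y <= ln (y + 1)) by (apply ln_le; lra).
      rewrite ln_Gamma_succ in * by auto. split; nra.
    - evar_last; [exact (proj1 (is_lim_seq_opp _ _) is_lim_seq_inv_INR)|]. simpl. now rewrite Ropp_0.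
    - apply is_lim_seq_const. }
  induction N as [|N IH]; intros x Hx HN.
  - apply Hbase. simpl in HN; lra.
  - destruct (Rle_or_lt x 1) as [H1|H1]; [apply Hbase; lra|].
    rewrite S_INR in HN. specialize (IH (x - 1) ltac:(lra) ltac:(lra)).
    apply is_lim_seq_ext with
      (fun n => Gauss_remainder (x - 1) n + (ln (INR n + 2) - ln (x + INR n))).
    + intros n. pose proof (pos_INR n). unfold Gauss_remainder.
      replace (x - 1 + INR n + 1) with (x + INR n) by ring.
      rewrite ln_Gamma_succ by lra. ring.
    + evar_last.
      * apply is_lim_seq_plus'; [exact IH|]. instantiate (1 := 0).
        apply is_lim_seq_le_le with (fun n => - (Rabs (2 - x) * / (INR n + 1)))
          (fun n => Rabs (2 - x) * / (INR n + 1)).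
        -- intros n. pose proof (pos_INR n).
           pose proof (ln_lipschitz (INR n + 1) (INR n + 2) (x + INR n)
             ltac:(lra) ltac:(lra) ltac:(lra)) as HL.
           replace (INR n + 2 - (x + INR n)) with (2 - x) in HL by ring.
           now apply Rabs_le_between.
        -- evar_last; [exact (proj1 (is_lim_seq_opp _ _) (is_lim_seq_scal_l _ _ _ is_lim_seq_inv_INR))|].
           simpl. now rewrite Rmult_0_r, Ropp_0.
        -- evar_last; [exact (is_lim_seq_scal_l _ _ _ is_lim_seq_inv_INR)|].
           simpl. now rewrite Rmult_0_r.
      * simpl. now rewrite Rplus_0_r.
Qed.

(** * Termwise differentiation *)

(** Two uses of the mean value theorem: [u] between [x] and [y] gives a point [c], then [v] between
    [x] and [c], with [c] no farther from [x] than [y] is. *)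
Lemma taylor_quadratic (u v w : R -> R) (M x y : R) :
  (forall z, Rmin x y <= z <= Rmax x y -> is_derive u z (v z)) ->
  (forall z, Rmin x y <= z <= Rmax x y -> is_derive v z (w z)) ->
  (forall z, Rmin x y <= z <= Rmax x y -> Rabs (w z) <= M) ->
  Rabs (u y - u x - (y - x) * v x) <= M * (y - x) ^ 2.
Proof.
  intros Hu Hv Hw.
  destruct (MVT_gen u x y v) as [c [Hc Ec]].
  { intros z Hz; apply Hu; lra. }
  { intros z Hz; apply continuity_pt_filterlim, (ex_derive_continuous u).
    exists (v z); now apply Hu. }
  assert (Hsub : forall z, Rmin x c <= z <= Rmax x c ->
    Rmin x y <= z <= Rmax x y /\ Rabs (z - x) <= Rabs (y - x)).
  { intros z; revert Hc; unfold Rmin, Rmax, Rabs.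
    repeat (destruct Rle_dec || destruct Rcase_abs); intros; split; lra. }
  assert (Hcx : Rabs (c - x) <= Rabs (y - x)).
  { apply Hsub; split; [apply Rmin_r | apply Rmax_r]. }
  destruct (MVT_gen v x c w) as [d [Hd Ed]].
  { intros z Hz; apply Hv, Hsub; lra. }
  { intros z Hz; apply continuity_pt_filterlim, (ex_derive_continuous v).
    exists (w z); apply Hv, Hsub; lra. }
  assert (HM : Rabs (w d) <= M) by apply Hw, Hsub, Hd.
  replace (u y - u x - (y - x) * v x) with (w d * ((c - x) * (y - x))) by nra.
  rewrite !Rabs_mult. rewrite <- (pow2_abs (y - x)).
  pose proof (Rabs_pos (w d)). pose proof (Rabs_pos (c - x)).
  pose proof (Rabs_pos (y - x)).
  apply Rmult_le_compat; auto; nra.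
Qed.

Lemma is_derive_quadratic (F : R -> R) (x l C : R) (d : posreal) :
  (forall y, Rabs (y - x) < d -> Rabs (F y - F x - (y - x) * l) <= C * (y - x) ^ 2) ->
  is_derive F x l.
Proof.
  intros H. apply is_derive_Reals. intros eps Heps.
  assert (HC : 0 < Rabs C + 1) by (pose proof (Rabs_pos C); lra).
  assert (Hp : 0 < Rmin d (eps / (Rabs C + 1))).
  { apply Rmin_pos; [apply cond_pos | now apply Rdiv_lt_0_compat]. }
  exists (mkposreal _ Hp). intros k Hk0 Hk. simpl in Hk.
  specialize (H (x + k)). replace (x + k - x) with k in H by ring.
  specialize (H (Rlt_le_trans _ _ _ Hk (Rmin_l _ _))).
  assert (Hke : Rabs k < eps / (Rabs C + 1)) by (eapply Rlt_le_trans; [exact Hk | apply Rmin_r]).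
  apply Rlt_div_r in Hke; auto.
  replace ((F (x + k) - F x) / k - l) with ((F (x + k) - F x - k * l) / k) by (field; auto).
  rewrite Rabs_div by auto.
  assert (Hak : 0 < Rabs k) by now apply Rabs_pos_lt.
  apply Rlt_div_l; auto.
  rewrite <- (pow2_abs k) in H. pose proof (Rle_abs C). nra.
Qed.

(* No uniform convergence is needed: the quadratic Taylor remainders sum to
   [Series M * (y - x) ^ 2]. Summability of [v] follows too, since [v k x] is
   [u k (x + 1) - u k x] up to a remainder at most [M k]. *)
Lemma Series_termwise_derive (u v w : nat -> R -> R) (M : nat -> R) (p : R) :
  (forall k x, p < x -> is_derive (u k) x (v k x)) ->
  (forall k x, p < x -> is_derive (v k) x (w k x)) ->
  (forall k x, p < x -> Rabs (w k x) <= M k) ->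
  ex_series M ->
  (forall x, p < x -> ex_series (fun k => u k x)) ->
  forall x, p < x ->
    ex_series (fun k => v k x) /\
    is_derive (fun y => Series (fun k => u k y)) x (Series (fun k => v k x)).
Proof.
  intros Hu Hv Hw HM Hs x Hx.
  assert (HT : forall k y, p < y ->
    Rabs (u k y - u k x - (y - x) * v k x) <= M k * (y - x) ^ 2).
  { intros k y Hy. apply taylor_quadratic with (w k);
      intros z Hz; [apply Hu | apply Hv | apply Hw];
      apply Rlt_le_trans with (2 := proj1 Hz); now apply Rmin_glb_lt. }
  assert (HE : forall y, p < y ->
    ex_series (fun k => u k y - u k x - (y - x) * v k x)).
  { intros y Hy. apply @ex_series_le with (fun k => M k * (y - x) ^ 2).
    - intros k; apply HT; auto.
    - now apply ex_series_scal_r. }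
  assert (Hev : ex_series (fun k => v k x)).
  { assert (Hx1 : p < x + 1) by lra.
    apply ex_series_ext with
      (fun k => (u k (x + 1) - u k x) - (u k (x + 1) - u k x - ((x + 1) - x) * v k x)).
    - intros k; simpl. ring.
    - apply @ex_series_minus; [apply @ex_series_minus|]; auto. }
  split; auto.
  assert (Hd : 0 < x - p) by lra.
  apply is_derive_quadratic with (C := Series M) (d := mkposreal _ Hd).
  intros y Hy. simpl in Hy. apply Rabs_lt_between in Hy.
  assert (Hpy : p < y) by lra.
  replace (Series (fun k => u k y) - Series (fun k => u k x)
             - (y - x) * Series (fun k => v k x))
    with (Series (fun k => u k y - u k x - (y - x) * v k x)).
  - rewrite <- Series_scal_r.
    apply Rle_trans with (Series (fun k => Rabs (u k y - u k x - (y - x) * v k x))).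
    + apply Series_Rabs. apply @ex_series_le with (fun k => M k * (y - x) ^ 2).
      * intros k. unfold norm; simpl; unfold abs; simpl; rewrite Rabs_Rabsolu; now apply HT.
      * now apply ex_series_scal_r.
    + apply Series_le.
      * intros k; split; [apply Rabs_pos | now apply HT].
      * now apply ex_series_scal_r.
  - rewrite Series_minus, Series_minus, Series_scal_l; auto.
    + apply @ex_series_minus; auto.
    + now apply @ex_series_scal_l.
Qed.

(** Once the first term is dropped, the series is dominated by the telescoping one with terms
    [/ (p + k) - / (p + k + 1)]. *)
Lemma ex_series_inv_sq p : 0 < p -> ex_series (fun k => / (p + INR k) ^ 2).
Proof.
  intros Hp.
  assert (Hk : forall k, 0 < p + INR k) by (intros k; pose proof (pos_INR k); lra).
  apply ex_series_incr_1.
  apply @ex_series_le with (fun k => / (p + INR k) - / (p + INR (S k))).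
  - intros k. specialize (Hk k). unfold norm; simpl norm; unfold abs; simpl abs.
    rewrite S_INR. rewrite Rabs_pos_eq.
    2:{ apply Rlt_le, Rinv_0_lt_compat, pow_lt; lra. }
    replace (/ (p + INR k) - / (p + (INR k + 1)))
      with (/ ((p + INR k) * (p + (INR k + 1)))) by (field; lra).
    apply Rinv_le_contravar; nra.
  - exists (/ p). unfold is_series.
    apply (is_lim_seq_ext (fun n => / p - / (p + INR (S n))) _ (/ p)).
    + intros n; induction n as [|n IH].
      * rewrite sum_O; simpl. now rewrite Rplus_0_r.
      * rewrite sum_Sn, <- IH. change plus with Rplus. cbv beta. ring.
    + evar_last. apply is_lim_seq_minus'.
      * apply is_lim_seq_const.
      * apply (is_lim_seq_inv _ p_infty); [|discriminate].
        apply is_lim_seq_plus with p p_infty; [apply is_lim_seq_const | |reflexivity].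
        apply (is_lim_seq_incr_1 INR), is_lim_seq_INR.
      * simpl. now rewrite Rminus_0_r.
Qed.

(** * The series for the logarithm of the Gamma function *)

(* [j] is the order of derivation. *)
Definition lnGamma_term (j k : nat) (x : R) : R :=
  match j with
  | O => (x - 1) * (ln (INR k + 2) - ln (INR k + 1)) + ln (INR k + 1) - ln (x + INR k)
  | 1%nat => ln (INR k + 2) - ln (INR k + 1) - / (x + INR k)
  | S (S i) => (-1) ^ i * INR (fact (S i)) * / (x + INR k) ^ S (S i)
  end.

Lemma lnGamma_term_derive j k x :
  0 < x -> is_derive (lnGamma_term j k) x (lnGamma_term (S j) k x).
Proof.
  intros Hx. pose proof (pos_INR k) as Hk.
  destruct j as [|[|i]]; unfold lnGamma_term.
  - auto_derive; [lra|]. field; lra.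
  - auto_derive; [lra|]. simpl. field; lra.
  - evar_last.
    + apply is_derive_scal. apply is_derive_inv.
      * apply is_derive_pow. auto_derive; auto.
      * apply pow_nonzero; lra.
    + rewrite (fact_simpl (S i)), mult_INR. simpl pred.
      assert ((x + INR k) ^ i <> 0) by (apply pow_nonzero; lra).
      cbn [pow]. field; lra.
Qed.

(** Of the [i + 2] factors [x + k] in the denominator, two are bounded below by [p + k], which gives
    summability in [k], and the others by [p]. *)
Lemma lnGamma_term_bound i k p x : 0 < p -> p < x ->
  Rabs (lnGamma_term (S (S i)) k x) <= INR (fact (S i)) / p ^ i * / (p + INR k) ^ 2.
Proof.
  intros Hp Hx. pose proof (pos_INR k) as Hk. unfold lnGamma_term.
  rewrite !Rabs_mult, pow_1_abs, Rmult_1_l.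
  rewrite (Rabs_pos_eq (INR _)) by apply pos_INR.
  unfold Rdiv; rewrite Rmult_assoc, <- Rinv_mult.
  apply Rmult_le_compat_l; [apply pos_INR|].
  assert (0 < p ^ i) by now apply pow_lt.
  assert (0 < (p + INR k) ^ 2) by (apply pow_lt; lra).
  rewrite Rabs_pos_eq by (apply Rlt_le, Rinv_0_lt_compat, pow_lt; lra).
  apply Rinv_le_contravar; [now apply Rmult_lt_0_compat|].
  replace (S (S i)) with (i + 2)%nat by lia. rewrite pow_add.
  apply Rmult_le_compat; try lra; apply pow_incr; lra.
Qed.

(* The constant [ln (Gamma 1)] (which is 0) is kept: it cancels in the ratio of Gammas,
   so its value is never needed. *)
Lemma lnGamma_is_series x : 0 < x ->
  is_series (fun k => lnGamma_term 0 k x) (ln (Gamma x) - ln (Gamma 1)).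
Proof.
  intros Hx.
  apply (is_lim_seq_ext (fun n => ln (Gamma x) - ln (Gamma 1) + Gauss_remainder x n)
    _ (ln (Gamma x) - ln (Gamma 1))).
  (* The partial sums satisfy this identity exactly for every [n]: each step telescopes through
     [ln_Gamma_succ]. *)
  - intros n. unfold Gauss_remainder. induction n as [|n IH].
    + rewrite sum_O. simpl. rewrite !Rplus_0_l, !Rplus_0_r, ln_1.
      replace 2 with (1 + 1) at 2 by ring.
      rewrite !ln_Gamma_succ, ln_1 by lra. ring.
    + rewrite sum_Sn, <- IH. change plus with Rplus. unfold lnGamma_term.
      pose proof (pos_INR n). rewrite !S_INR.
      replace (INR n + 1 + 2) with (INR n + 2 + 1) by ring.
      replace (INR n + 1 + 1) with (INR n + 2) by ring.
      replace (x + (INR n + 1) + 1) with (x + INR n + 1 + 1) by ring.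
      replace (x + (INR n + 1)) with (x + INR n + 1) by ring.
      rewrite !ln_Gamma_succ by lra. ring.
  - evar_last.
    + apply is_lim_seq_plus'; [apply is_lim_seq_const | now apply Gauss_remainder_lim].
    + now rewrite Rplus_0_r.
Qed.

Definition lnGamma_n (j : nat) (x : R) : R := Series (fun k => lnGamma_term j k x).

(** Termwise derivation at one order also yields summability at the next, so Gauss' formula is
    needed only to start at order 0. *)
Lemma lnGamma_n_derivable j x : 0 < x ->
  ex_series (fun k => lnGamma_term j k x) /\
  is_derive (lnGamma_n j) x (lnGamma_n (S j) x).
Proof.
  assert (Hstep : forall j, (forall x, 0 < x -> ex_series (fun k => lnGamma_term j k x)) ->
    forall x, 0 < x -> ex_series (fun k => lnGamma_term (S j) k x) /\
      is_derive (lnGamma_n j) x (lnGamma_n (S j) x)).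
  { clear j x; intros j Hj x Hx.
    (* The base point [x / 2] stays away from 0, where the bound on the terms degenerates, while
       leaving room on both sides of [x]. *)
    apply (Series_termwise_derive (lnGamma_term j) (lnGamma_term (S j)) (lnGamma_term (S (S j)))
      (fun k => INR (fact (S j)) / (x / 2) ^ j * / (x / 2 + INR k) ^ 2) (x / 2)); try lra.
    - intros k y Hy; apply lnGamma_term_derive; lra.
    - intros k y Hy; apply lnGamma_term_derive; lra.
    - intros k y Hy; apply lnGamma_term_bound; lra.
    - apply (ex_series_scal_l (INR (fact (S j)) / (x / 2) ^ j) (fun k => / (x / 2 + INR k) ^ 2)).
      apply ex_series_inv_sq; lra.
    - intros y Hy; apply Hj; lra. }
  revert x; induction j as [|j IH]; intros x Hx.
  - split; [eexists; now apply lnGamma_is_series | apply Hstep; auto; intros y Hy; eexists; now apply lnGamma_is_series].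
  - assert (Hj : forall y, 0 < y -> ex_series (fun k => lnGamma_term (S j) k y)).
    { intros y Hy; apply Hstep; auto. intros z Hz; now apply IH. }
    split; [now apply Hj | now apply Hstep].
Qed.

Lemma lnGamma_n_sign j x : 0 < x -> 0 <= (-1) ^ j * lnGamma_n (S (S j)) x.
Proof.
  intros Hx. unfold lnGamma_n. rewrite <- Series_scal_l.
  (* Zero is written as the series of [0 * 0], so that [Series_scal_l] evaluates it and [Series_le]
     compares it termwise. *)
  apply Rle_trans with (Series (fun _ => 0 * 0)).
  { rewrite (Series_scal_l 0 (fun _ => 0)); lra. }
  apply Series_le.
  - intros k; split; [lra|]. unfold lnGamma_term. pose proof (pos_INR k).
    replace ((-1) ^ j * ((-1) ^ j * INR (fact (S j)) * / (x + INR k) ^ S (S j)))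
      with (((-1) * (-1)) ^ j * INR (fact (S j)) * / (x + INR k) ^ S (S j))
      by (rewrite Rpow_mult_distr; ring).
    replace (-1 * -1) with 1 by ring. rewrite pow1, !Rmult_1_l, Rmult_0_l.
    apply Rmult_le_pos; [apply pos_INR|].
    apply Rlt_le, Rinv_0_lt_compat, pow_lt; lra.
  - apply (ex_series_scal_l ((-1) ^ j) (fun k => lnGamma_term (S (S j)) k x)).
    apply lnGamma_n_derivable; auto.
Qed.

(** * The quotient of two Gamma values *)

Lemma Gamma_ratio_lcm_iff (p q c : R) (f : R -> R) : 0 < q < p -> 0 < c ->
  (forall x, 0 < x -> f x = exp ((ln c + (ln (Gamma (x + p)) - ln (Gamma (x + q)))) / x)) ->
  (log_completely_monotonic 0 p_infty f <-> 0 <= ln c + (ln (Gamma p) - ln (Gamma q))).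
Proof.
  intros Hqp Hc Hf.
  (* The constant [ln c] survives only at order 0. Since [p] and [q] are positive, [G] is regular up
     to and including [x = 0], as the quotient criterion demands. *)
  set (G := fun k x => (match k with O => ln c | _ => 0 end)
                       + (lnGamma_n k (x + p) - lnGamma_n k (x + q))).
  assert (HG0 : forall x, 0 <= x -> G O x = ln c + (ln (Gamma (x + p)) - ln (Gamma (x + q)))).
  { intros x Hx. unfold G, lnGamma_n.
    rewrite (is_series_unique _ _ (lnGamma_is_series (x + p) ltac:(lra))).
    rewrite (is_series_unique _ _ (lnGamma_is_series (x + q) ltac:(lra))). ring. }
  assert (E0 : G O 0 = ln c + (ln (Gamma p) - ln (Gamma q))).
  { rewrite HG0 by lra. now rewrite !Rplus_0_l. }
  rewrite <- E0. apply exp_quot_lcm_iff.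
  - intros k x Hx. unfold G.
    assert (Hd : forall r, 0 < r ->
      is_derive (fun y => lnGamma_n k (y + r)) x (lnGamma_n (S k) (x + r))).
    { intros r Hr.
      assert (Hxr : 0 < x + r) by lra.
      rewrite <- (Rmult_1_l (lnGamma_n (S k) (x + r))).
      apply (is_derive_comp (lnGamma_n k) (fun y => y + r)).
      - exact (proj2 (lnGamma_n_derivable k (x + r) Hxr)).
      - auto_derive; [exact I | reflexivity]. }
    apply (is_derive_plus (fun _ => match k with O => ln c | _ => 0 end)).
    + apply (is_derive_const (match k with O => ln c | _ => 0 end)).
    + apply (is_derive_minus (fun y => lnGamma_n k (y + p)) (fun y => lnGamma_n k (y + q)));
        apply Hd; lra.
  - intros k x Hx.
    (* The sign of the derivative of order [k + 2] makes the signed derivative of order [k + 1]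
       nondecreasing, and [x + q] lies below [x + p]. *)
    assert (Hm : (-1) ^ k * lnGamma_n (S k) (x + q) <= (-1) ^ k * lnGamma_n (S k) (x + p)).
    { apply (incr_from_derive (fun y => (-1) ^ k * lnGamma_n (S k) y)
        (fun y => (-1) ^ k * lnGamma_n (S (S k)) y)); try lra.
      - intros z Hz. apply is_derive_scal. apply (proj2 (lnGamma_n_derivable (S k) z ltac:(lra))).
      - intros z Hz. apply lnGamma_n_sign; lra. }
    unfold G. lra.
  - intros x Hx. rewrite Hf, HG0 by lra. reflexivity.
Qed.

Theorem theorem1p1 (a b c : R) (ha : 0 < a) (hb : 0 < b) (hc : 0 < c) :
  (a > b ->
     (log_completely_monotonic 0 p_infty (h a b c) <-> c >= Gamma b / Gamma a)) /\
  (a < b ->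
     (log_completely_monotonic 0 p_infty (fun x => 1 / h a b c x) <->
        c <= Gamma b / Gamma a)).
Proof.
  pose proof (Gamma_pos a ha) as HA. pose proof (Gamma_pos b hb) as HB.
  assert (Hr : 0 < Gamma b / Gamma a) by now apply Rdiv_lt_0_compat.
  assert (Hrl : ln (Gamma b / Gamma a) = ln (Gamma b) - ln (Gamma a)) by now apply ln_div.
  assert (Hh : forall x, 0 < x ->
    h a b c x = exp ((ln c + (ln (Gamma (x + a)) - ln (Gamma (x + b)))) / x)).
  { intros x Hx. unfold h, Rpower.
    assert (0 < Gamma (x + a)) by (apply Gamma_pos; lra).
    assert (0 < Gamma (x + b)) by (apply Gamma_pos; lra).
    rewrite ln_mult, ln_div by (auto; now apply Rdiv_lt_0_compat).
    f_equal. field; lra. }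
  split; intros Hab.
  - rewrite (Gamma_ratio_lcm_iff a b c (h a b c)) by (auto; lra).
    split; intros H.
    + apply Rle_ge, ln_le_reg; auto. lra.
    + apply Rge_le, ln_le in H; auto. lra.
  (* Taking the reciprocal negates the exponent, which swaps [a] with [b] and turns [ln c] into
     [ln (/ c)]. *)
  - rewrite (Gamma_ratio_lcm_iff b a (/ c) (fun x => 1 / h a b c x)); try lra.
    + rewrite ln_Rinv by auto. split; intros H.
      * apply ln_le_reg; auto. lra.
      * apply ln_le in H; auto. lra.
    + now apply Rinv_0_lt_compat.
    + intros x Hx. rewrite Hh by auto. unfold Rdiv at 1. rewrite Rmult_1_l, <- exp_Ropp.
      rewrite ln_Rinv by auto. f_equal. field; lra.
Qed.
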